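(* Let $d\ge 1$ and let $X\in\mathfrak{gl}_d(\mathbb{C})$ be a matrix with an eigenvalue which is not purely imaginary (i.e. an eigenvalue $\alpha$ with $\Re(\alpha)\neq 0$). Then every local limit, under conjugacy in $\mathrm{GL}_d(\mathbb{C})$, of the one-dimensional closed subgroup $H=\{\exp(tX)\mid t\in\mathbb{R}\}\le \mathrm{GL}_d(\mathbb{C})$ is one-dimensional (as a real Lie group).
   Context: A sequence of closed subgroups $H_n\le G$ converges to $H\le G$ (Chabauty topology) if (1) every $h\in H$ is a limit of some sequence $h_n\in H_n$, and (2) whenever $h_n\in H_n$ and a subsequence $h_{n_k}$ converges to $h$, then $h\in H$. A connected subgroup $L$ is a *local limit* of a connected closed subgroup $H$ under conjugacy in $G$ if there is a sequence $p_n\in G$ such that $p_nHp_n^{-1}$ converges to some closed subgroup $L'$ of $G$ and $L$ is the identity component of $L'$. The number $0$ counts as purely imaginary. *)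

(* Defs.v *)
From HB Require Import structures.
From mathcomp Require Import all_boot all_order all_algebra.
From mathcomp Require Import complex.
From mathcomp Require Import all_classical all_reals all_analysis.
Set Implicit Arguments.
Unset Strict Implicit.
Unset Printing Implicit Defensive.
Import Order.TTheory GRing.Theory Num.Theory.
Import numFieldNormedType.Exports.
Local Open Scope classical_set_scope.
Local Open Scope complex_scope.
Local Open Scope ring_scope.

(* The topology of R[i] is the one given by the modulus, as for every
   numFieldType; matrices over R[i] inherit the entrywise topology. *)
#[export, non_forgetful_inheritance]
HB.instance Definition _ (R : realType) :=
  NormedModule.copy R[i] ((R[i] : numFieldType)^o).

Definition expmx (R : realType) (d : nat) (X : 'M[R[i]]_d.+1) : 'M[R[i]]_d.+1 :=
  lim (series (fun k : nat => (k`!%:R : R[i])^-1 *: X ^+ k) @ \oo).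

Definition one_param (R : realType) (d : nat) (X : 'M[R[i]]_d.+1) :
    set 'M[R[i]]_d.+1 :=
  [set expmx (t%:C *: X) | t in [set: R]].

(* Subsets of the complex general linear group are sets of matrices contained
   in [GL R d]; its topology is the subspace topology. *)
Definition GL (R : realType) (d : nat) : set 'M[R[i]]_d.+1 :=
  [set g | g \is a GRing.unit].

Arguments GL R d : clear implicits.

(* [A] is closed relatively to [GL R d], not in the space of all matrices. *)
Definition closed_subgroup (R : realType) (d : nat) (A : set 'M[R[i]]_d.+1) :
    Prop :=
  [/\ A `<=` GL R d,
      A 1,
      forall g h, A g -> A h -> A (g * h),
      forall g, A g -> A g^-1
    & closure A `&` GL R d `<=` A].

Definition conj_set (R : realType) (d : nat) (p : 'M[R[i]]_d.+1)
    (A : set 'M[R[i]]_d.+1) : set 'M[R[i]]_d.+1 :=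
  [set p * h * p^-1 | h in A].

Definition chabauty_cvg (R : realType) (d : nat)
    (A_ : nat -> set 'M[R[i]]_d.+1) (A : set 'M[R[i]]_d.+1) : Prop :=
  (forall h, A h ->
     exists2 h_ : nat -> 'M[R[i]]_d.+1, forall n, A_ n (h_ n) & h_ @ \oo --> h)
  /\
  (forall (h_ : nat -> 'M[R[i]]_d.+1) (phi : nat -> nat) (h : 'M[R[i]]_d.+1),
     (forall n, A_ n (h_ n)) -> {homo phi : m n / (m < n)%N} ->
     GL R d h -> (h_ \o phi) @ \oo --> h -> A h).

Definition local_limit (R : realType) (d : nat) (H L : set 'M[R[i]]_d.+1) :
    Prop :=
  exists (p : nat -> 'M[R[i]]_d.+1) (L' : set 'M[R[i]]_d.+1),
    [/\ forall n, GL R d (p n),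
        closed_subgroup L',
        chabauty_cvg (fun n => conj_set (p n) H) L'
      & L = connected_component L' 1].

(* The Lie algebra of a closed subgroup of the general linear group. *)
Definition lie_algebra (R : realType) (d : nat) (A : set 'M[R[i]]_d.+1) :
    set 'M[R[i]]_d.+1 :=
  [set Y | forall t : R, A (expmx (t%:C *: Y))].

(* [k] is the dimension of the closed subgroup [A] as a real Lie group: its Lie
   algebra has a basis of [k] matrices over the reals (not over R[i]). *)
Definition real_lie_dim (R : realType) (d : nat) (A : set 'M[R[i]]_d.+1)
    (k : nat) : Prop :=
  exists Y : 'I_k -> 'M[R[i]]_d.+1,
    (forall c : 'I_k -> R,
       \sum_(i < k) (c i)%:C *: Y i = 0 -> forall i, c i = 0)
    /\
    lie_algebra A = [set \sum_(i < k) (c i)%:C *: Y i | c in [set: 'I_k -> R]].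

(* Main.v *)
Require Import Defs.
From mathcomp Require Import all_boot all_order all_algebra.
From mathcomp Require Import complex.
From mathcomp Require Import all_classical all_reals all_analysis.
From mathcomp Require Import ring lra.
Set Implicit Arguments.
Unset Strict Implicit.
Unset Printing Implicit Defensive.
Import Order.TTheory GRing.Theory Num.Theory.
Import numFieldNormedType.Exports.
Import Normc.
Local Open Scope classical_set_scope.
Local Open Scope complex_scope.
Local Open Scope ring_scope.

(* Put X_n = p_n X p_n^-1.  If exp(t_n X_n) is close to 1 then, the eigenvalue
   exp(t_n alpha) being close to 1 and Re alpha being nonzero, t_n is small, so
   that all eigenvalues of A = t_n X_n are small.  By Cayley-Hamilton the powers
   A^k with k > d are then small compared with the lower ones, and A itself is,
   up to a small error, a fixed linear combination of 1, exp A, ..., exp (m A).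
   Hence t_n X_n is small: near 1, the group exp(R X_n) is the image under exp
   of the line R X_n inside a ball on which exp is injective.  The Lie algebra
   of the limit is therefore the limit of the lines R X_n along any convergent
   subsequence, again a real line. *)

(** * A submultiplicative real norm on complex matrices *)

Section Norm1.
Context {R : realType}.
Implicit Types (z : R[i]) (m n p : nat).

Lemma normc_ge0 z : 0 <= normc z.
Proof. by case: z => x y; rewrite /normc sqrtr_ge0. Qed.

Lemma normc_normr z : `|z| = (normc z)%:C.
Proof. by []. Qed.

Lemma normcR (t : R) : normc t%:C = `|t|.
Proof. by rewrite /normc /= expr0n addr0 sqrtr_sqr. Qed.

Lemma normRe_le z : `|complex.Re z| <= normc z.
Proof. by rewrite -lecR -normc_normr; exact: normc_ge_Re. Qed.

Lemma normIm_le z : `|complex.Im z| <= normc z.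
Proof.
case: z => x y; rewrite /normc /= -sqrtr_sqr ler_wsqrtr //.
by rewrite lerDr sqr_ge0.
Qed.

Lemma normc_le_ReIm z : normc z <= `|complex.Re z| + `|complex.Im z|.
Proof.
rewrite [z in normc z]complexE; apply: le_trans (le_normcD _ _) _.
by rewrite normcM !normcR /= /normc expr0n expr1n add0r sqrtr1 mul1r.
Qed.

(* The entrywise sum of moduli, unlike the library's maximum norm, is
   submultiplicative and takes its values in [R] rather than [R[i]]. *)
Definition norm1 m n (A : 'M[R[i]]_(m, n)) : R :=
  \sum_i \sum_j normc (A i j).

Lemma norm1_ge0 m n (A : 'M[R[i]]_(m, n)) : 0 <= norm1 A.
Proof. by apply: sumr_ge0 => i _; apply: sumr_ge0 => j _; exact: normc_ge0. Qed.

Lemma norm1_entry m n (A : 'M[R[i]]_(m, n)) i j : normc (A i j) <= norm1 A.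
Proof.
rewrite /norm1 (bigD1 i) //= (bigD1 j) //= -addrA lerDl addr_ge0 //.
  by apply: sumr_ge0 => *; exact: normc_ge0.
by apply: sumr_ge0 => *; apply: sumr_ge0 => *; exact: normc_ge0.
Qed.

Lemma norm1_eq0 m n (A : 'M[R[i]]_(m, n)) : norm1 A = 0 -> A = 0.
Proof.
move=> A0; apply/matrixP => i j; rewrite mxE; apply: eq0_normc.
by apply/eqP; rewrite eq_le normc_ge0 andbT -A0 norm1_entry.
Qed.

Lemma norm1_0 m n : norm1 (0 : 'M[R[i]]_(m, n)) = 0.
Proof. by apply: big1 => i _; apply: big1 => j _; rewrite mxE normc0. Qed.

Lemma norm1_gt0 m n (A : 'M[R[i]]_(m, n)) : A != 0 -> 0 < norm1 A.
Proof.
move=> A0; rewrite lt_def norm1_ge0 andbT.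
by apply: contra A0 => /eqP/norm1_eq0 ->.
Qed.

Lemma norm1D m n (A B : 'M[R[i]]_(m, n)) : norm1 (A + B) <= norm1 A + norm1 B.
Proof.
rewrite /norm1 -big_split; apply: ler_sum => i _ /=.
rewrite -big_split; apply: ler_sum => j _ /=.
by rewrite mxE; exact: le_normcD.
Qed.

Lemma norm1N m n (A : 'M[R[i]]_(m, n)) : norm1 (- A) = norm1 A.
Proof.
by apply: eq_bigr => i _; apply: eq_bigr => j _; rewrite mxE normcN.
Qed.

Lemma norm1B m n (A B : 'M[R[i]]_(m, n)) : norm1 (A - B) <= norm1 A + norm1 B.
Proof. by rewrite -(norm1N B) norm1D. Qed.

Lemma norm1Z m n z (A : 'M[R[i]]_(m, n)) : norm1 (z *: A) = normc z * norm1 A.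
Proof.
rewrite /norm1 mulr_sumr; apply: eq_bigr => i _; rewrite mulr_sumr.
by apply: eq_bigr => j _; rewrite mxE normcM.
Qed.

Lemma norm1_sum m n (I : Type) (r : seq I) (P : pred I)
    (A : I -> 'M[R[i]]_(m, n)) :
  norm1 (\sum_(i <- r | P i) A i) <= \sum_(i <- r | P i) norm1 (A i).
Proof.
elim/big_rec2: _ => [|i x y _ le_yx]; first by rewrite norm1_0.
by apply: le_trans (norm1D _ _) _; rewrite lerD2l.
Qed.

Lemma normc_sum (I : Type) (r : seq I) (P : pred I) (f : I -> R[i]) :
  normc (\sum_(i <- r | P i) f i) <= \sum_(i <- r | P i) normc (f i).
Proof.
elim/big_rec2: _ => [|i x y _ le_yx]; first by rewrite normc0.
by apply: le_trans (le_normcD _ _) _; rewrite lerD2l.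
Qed.

Lemma norm1M m n p (A : 'M[R[i]]_(m, n)) (B : 'M[R[i]]_(n, p)) :
  norm1 (A *m B) <= norm1 A * norm1 B.
Proof.
rewrite /norm1 mulr_suml; apply: ler_sum => i _.
apply: (@le_trans _ _ (\sum_j \sum_k normc (A i k) * normc (B k j))).
  apply: ler_sum => j _; rewrite mxE; apply: le_trans (normc_sum _ _ _) _.
  by apply: ler_sum => k _; rewrite normcM.
rewrite exchange_big /= mulr_suml; apply: ler_sum => k _.
rewrite -mulr_sumr ler_wpM2l ?normc_ge0 // (bigD1 k) //= lerDl.
by apply: sumr_ge0 => *; apply: sumr_ge0 => *; exact: normc_ge0.
Qed.

Lemma norm1_1 n : norm1 (1%:M : 'M[R[i]]_n) = n%:R.
Proof.
rewrite /norm1 (eq_bigr (fun=> 1)) ?sumr_const ?card_ord // => i _.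
rewrite (bigD1 i) //= mxE eqxx normc1 big1 ?addr0 // => j /negPf.
by rewrite eq_sym mxE => ->; rewrite normc0.
Qed.

Lemma norm1X n (A : 'M[R[i]]_n.+1) k : norm1 (A ^+ k) <= n.+1%:R * norm1 A ^+ k.
Proof.
elim: k => [|k IHk]; first by rewrite !expr0 mulr1 norm1_1.
rewrite !exprSr mulrA; apply: le_trans (norm1M _ _) _.
by rewrite ler_wpM2r ?norm1_ge0.
Qed.

Lemma norm1XS n (A : 'M[R[i]]_n.+1) k : norm1 (A ^+ k.+1) <= norm1 A ^+ k.+1.
Proof.
elim: k => [|k IHk]; first by rewrite !expr1.
rewrite [A ^+ _]exprS [leRHS]exprS; apply: le_trans (norm1M _ _) _.
by rewrite ler_wpM2l ?norm1_ge0.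
Qed.

(** The two norms are equivalent: the largest modulus is at most [norm1], which is at most the
    number of entries times it. All later limits are thereby computed with real numbers. *)
Lemma cvg_norm1 {T : Type} (F : set_system T) {FF : Filter F} n
    (f : T -> 'M[R[i]]_n.+1) (l : 'M[R[i]]_n.+1) :
  f @ F --> l <-> (fun x => norm1 (f x - l)) @ F --> (0 : R).
Proof.
split=> [/cvg_ballP fl|/cvgrPdist_lt fl].
  apply/cvgrPdist_le => e e0.
  pose e' : R := e / (n.+1 * n.+1)%:R.
  have e'0 : 0 < e' by rewrite divr_gt0 // ltr0n muln_gt0.
  have := fl e'%:C; rewrite ltcR => /(_ e'0).
  apply: filterS => x [_ xl].
  rewrite sub0r normrN ger0_norm ?norm1_ge0 //.
  apply: (@le_trans _ _ (\sum_(i < n.+1) \sum_(j < n.+1) e')).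
    apply: ler_sum => i _; apply: ler_sum => j _; rewrite !mxE.
    rewrite -normcN opprB ltW // -ltcR; exact: xl.
  rewrite !sumr_const !card_ord -mulrnA -mulr_natr /e'.
  by rewrite divfK // lt0r_neq0 // ltr0n muln_gt0.
(* The radius of a ball is a complex number here; its positivity forces the imaginary part to
   vanish. *)
apply/cvg_ballP => -[e e']; rewrite ltcE /= => /andP[/eqP -> e0].
have := fl e e0; apply: filterS => x.
rewrite sub0r normrN ger0_norm ?norm1_ge0 // => xl.
split=> [|i j]; first by rewrite ltcR.
rewrite -ball_normE /= normc_normr ltcR -normcN opprB.
by apply: le_lt_trans xl; have := norm1_entry (f x - l) i j; rewrite !mxE.
Qed.
End Norm1.

(** * Limits of matrix sequences and absolutely convergent series *)

Section Limits.
Context {R : realType} {d : nat}.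
Implicit Types (A B : 'M[R[i]]_d.+1).

Lemma cvg_mx_ReIm {T : Type} (F : set_system T) {FF : Filter F}
    (f : T -> 'M[R[i]]_d.+1) A :
  (forall i j, complex.Re (f x i j) @[x --> F] --> complex.Re (A i j)) ->
  (forall i j, complex.Im (f x i j) @[x --> F] --> complex.Im (A i j)) ->
  f @ F --> A.
Proof.
move=> fRe fIm; apply/cvg_norm1.
pose g x := \sum_(i < d.+1) \sum_(j < d.+1)
  (`|complex.Re (f x i j) - complex.Re (A i j)| +
   `|complex.Im (f x i j) - complex.Im (A i j)|).
apply: (@squeeze_cvgr _ _ _ _ (fun=> 0) g).
- near=> x; rewrite norm1_ge0 /=; apply: ler_sum => i _; apply: ler_sum => j _.
  rewrite !mxE; apply: le_trans (normc_le_ReIm _) _.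
  by case: (f x i j) => a b; case: (A i j) => a' b'.
- exact: cvg_cst.
have -> : (0 : R) = \sum_(i < d.+1) \sum_(j < d.+1) (0 + 0).
  by rewrite big1 // => i _; rewrite big1 // addr0.
apply: cvg_big => [|i _]; first exact: add_continuous.
apply: cvg_big => [|j _]; first exact: add_continuous.
apply: cvgD.
  have := cvg_norm (cvgB (fRe i j) (cvg_cst (complex.Re (A i j)))).
  by rewrite subrr normr0; exact.
have := cvg_norm (cvgB (fIm i j) (cvg_cst (complex.Im (A i j)))).
by rewrite subrr normr0; exact.
Unshelve. all: by end_near. Qed.

Lemma cvg_norm1_norm {T : Type} (F : set_system T) {FF : Filter F}
    (f : T -> 'M[R[i]]_d.+1) A :
  f @ F --> A -> norm1 (f x) @[x --> F] --> norm1 A.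
Proof.
move=> /cvg_norm1/cvgrPdist_lt fA; apply/cvgrPdist_lt => e /fA.
apply: filterS => x; rewrite sub0r normrN ger0_norm ?norm1_ge0 //.
apply: le_lt_trans; rewrite ler_norml lerBlDr lerBDr.
have := norm1D (f x - A) A; have := norm1B (f x) (f x - A).
by rewrite subKr subrK; lra.
Qed.

Lemma norm1_cvg_le (u : nat -> 'M[R[i]]_d.+1) A (b : R) :
  u @ \oo --> A -> (\forall n \near \oo, norm1 (u n) <= b) -> norm1 A <= b.
Proof.
by move=> /cvg_norm1_norm uA ub; exact: (ler_cvg_to uA (cvg_cst b)).
Qed.

Lemma cvg_mx_unique {T : Type} (F : set_system T) {FF : ProperFilter F}
    (f : T -> 'M[R[i]]_d.+1) A B :
  f @ F --> A -> f @ F --> B -> A = B.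
Proof. by move=> fA fB; apply: cvg_unique fA fB; exact: norm_hausdorff. Qed.

Lemma cvg_mxM {T : Type} (F : set_system T) {FF : Filter F}
    (f g : T -> 'M[R[i]]_d.+1) A B :
  f @ F --> A -> g @ F --> B -> f x * g x @[x --> F] --> A * B.
Proof.
move=> fA gB.
have nf : norm1 (f x) @[x --> F] --> norm1 A by exact: cvg_norm1_norm.
apply/cvg_norm1.
move: fA gB => /cvg_norm1 fA /cvg_norm1 gB.
apply: (@squeeze_cvgr _ _ _ _ (fun=> 0)
  (fun x => norm1 (f x) * norm1 (g x - B) + norm1 (f x - A) * norm1 B)).
- near=> x; rewrite norm1_ge0 /=.
  have -> : f x * g x - A * B = f x * (g x - B) + (f x - A) * B.
    by rewrite mulrBr mulrBl addrA subrK.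
  by apply: le_trans (norm1D _ _) _; rewrite lerD // norm1M.
- exact: cvg_cst.
rewrite -[X in _ --> X]addr0; apply: cvgD.
  by have := cvgM nf gB; rewrite mulr0; exact.
by have := cvgM fA (cvg_cst (norm1 B)); rewrite mul0r; exact.
Unshelve. all: by end_near. Qed.

Lemma cvg_mxB {T : Type} (F : set_system T) {FF : Filter F}
    (f g : T -> 'M[R[i]]_d.+1) A B :
  f @ F --> A -> g @ F --> B -> f x - g x @[x --> F] --> A - B.
Proof.
move=> /cvg_norm1 fA /cvg_norm1 gB; apply/cvg_norm1.
apply: (@squeeze_cvgr _ _ _ _ (fun=> 0)
  (fun x => norm1 (f x - A) + norm1 (g x - B))).
- near=> x; rewrite norm1_ge0 /=.
  have -> : f x - g x - (A - B) = f x - A - (g x - B).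
    by rewrite !opprB (addrC B) addrACA (addrC B (- g x)).
  exact: norm1B.
- exact: cvg_cst.
by have := cvgD fA gB; rewrite addr0; exact.
Unshelve. all: by end_near. Qed.

Lemma cvg_mx_close {T : Type} (F : set_system T) {FF : Filter F}
    (f g : T -> 'M[R[i]]_d.+1) A :
  f @ F --> A -> norm1 (f x - g x) @[x --> F] --> (0 : R) -> g @ F --> A.
Proof.
move=> /cvg_norm1 fA fg; apply/cvg_norm1.
apply: (@squeeze_cvgr _ _ _ _ (fun=> 0)
  (fun x => norm1 (f x - A) + norm1 (f x - g x))).
- near=> x; rewrite norm1_ge0 /=.
  have -> : g x - A = f x - A - (f x - g x) by rewrite opprB [RHS]addrC addrA subrK.
  exact: norm1B.
- exact: cvg_cst.
by have := cvgD fA fg; rewrite addr0; exact.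
Unshelve. all: by end_near. Qed.

(** The real and imaginary parts of each entry are dominated by the norms, so completeness of the
    reals provides the limit entry by entry. *)
Lemma normal_cvg_series (u : nat -> 'M[R[i]]_d.+1) :
  cvgn (series (fun k => norm1 (u k))) -> cvgn (series u).
Proof.
move=> uN.
have cvg_coord (h : R[i] -> R) (i j : 'I_d.+1) :
    (forall z, `|h z| <= normc z) -> cvgn (series (fun k => h (u k i j))).
  move=> hle; apply: normed_cvg.
  apply: series_le_cvg uN => n //=; first exact: norm1_ge0.
  exact: le_trans (hle _) (norm1_entry _ _ _).
pose L (h : R[i] -> R) i j := limn (series (fun k => h (u k i j))).
apply/cvg_ex.
exists (\matrix_(i, j) (L (@complex.Re R) i j +i* L (@complex.Im R) i j)).
have Reser i j n : complex.Re (series u n i j) =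
    series (fun k => complex.Re (u k i j)) n.
  by rewrite /series /= summxE; apply: big_morph => // -[? ?] [? ?].
have Imser i j n : complex.Im (series u n i j) =
    series (fun k => complex.Im (u k i j)) n.
  by rewrite /series /= summxE; apply: big_morph => // -[? ?] [? ?].
apply: cvg_mx_ReIm => i j; rewrite mxE /=.
  under eq_fun do rewrite Reser.
  by apply: cvg_coord; exact: normRe_le.
under eq_fun do rewrite Imser.
by apply: cvg_coord; exact: normIm_le.
Qed.

End Limits.

(** * Convergence of the exponential series *)

Section Exponential.
Context {R : realType} {d : nat}.
Implicit Types (A B : 'M[R[i]]_d.+1).

Definition expmx_coeff A (k : nat) : 'M[R[i]]_d.+1 := (k`!%:R)^-1 *: A ^+ k.

Lemma normc_invfact k : normc (k`!%:R : R[i])^-1 = (k`!%:R)^-1.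
Proof.
have -> : (k`!%:R : R[i])^-1 = ((k`!%:R : R)^-1)%:C.
  by rewrite fmorphV /= rmorph_nat.
by rewrite normcR ger0_norm // invr_ge0 ler0n.
Qed.

(** The factor [d.+1] is the norm of the identity and is needed for the order zero. *)
Lemma norm1_expmx_coeff A k :
  norm1 (expmx_coeff A k) <= d.+1%:R * exp_coeff (norm1 A) k.
Proof.
rewrite norm1Z normc_invfact /exp_coeff /= mulrA [leRHS]mulrC.
by rewrite ler_wpM2l ?norm1X // invr_ge0 ler0n.
Qed.

Lemma expmx_cvg A : series (expmx_coeff A) @ \oo --> expmx A.
Proof.
suff: cvgn (series (expmx_coeff A)) by [].
apply: normal_cvg_series.
apply: series_le_cvg (@is_cvg_seriesZ _ _ d.+1%:R (is_cvg_series_exp_coeff (norm1 A))).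
- by move=> k; exact: norm1_ge0.
- by move=> k; rewrite mulr_ge0 ?exp_coeff_ge0 ?norm1_ge0.
- by move=> k; exact: norm1_expmx_coeff.
Qed.

Lemma sum_exp_coeff_le (x : R) n :
  0 <= x -> \sum_(0 <= k < n) exp_coeff x k <= expR x.
Proof.
move=> x0; apply: nondecreasing_cvgn_le (is_cvg_series_exp_coeff x) n.
apply/nondecreasing_seqP => n; rewrite /series /= big_nat_recr //= lerDl.
exact: exp_coeff_ge0.
Qed.

End Exponential.
Arguments expmx_cvg {R d} A.

(** * Cauchy products of truncated exponential series *)

Section CauchyProduct.

(** Induction on [n]: passing to [n.+1] adds the antidiagonal of indices with sum [n] to both
    sides. *)
Lemma sum_triangle (V : zmodType) (F : nat -> nat -> V) n :
  \sum_(0 <= k < n) \sum_(i < k.+1) F i (k - i)%N =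
  \sum_(0 <= i < n) \sum_(0 <= j < n - i) F i j.
Proof.
elim: n => [|n IHn]; first by rewrite !big_nil.
rewrite big_nat_recr //= IHn [RHS]big_nat_recr //= subSnn big_nat1 big_ord_recr.
rewrite /= subnn addrA; congr (_ + _).
rewrite -(big_mkord xpredT (fun i => F i (n - i)%N)) -big_split /=.
by apply: eq_big_nat => i /andP[_ ilt]; rewrite subSn ?(ltnW ilt) // big_nat_recr.
Qed.

Lemma sum_square (V : zmodType) (F : nat -> nat -> V) n :
  \sum_(0 <= i < n) \sum_(0 <= j < n) F i j -
  \sum_(0 <= k < n) \sum_(i < k.+1) F i (k - i)%N =
  \sum_(0 <= i < n) \sum_(n - i <= j < n) F i j.
Proof.
rewrite sum_triangle -sumrB; apply: eq_bigr => i _.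
by rewrite (@big_cat_nat _ _ _ (n - i)%N) ?leq_subr //= addrAC subrr add0r.
Qed.

(** The binomial theorem for commuting elements, with the binomial coefficient over [k!] equal to
    the product of the inverses of [i!] and [(k - i)!]. *)
Lemma exp_sum_convolution (K : numFieldType) (L : algType K) (x y : L) k :
  x * y = y * x ->
  (k`!%:R)^-1 *: (x + y) ^+ k =
  \sum_(i < k.+1) (((k - i)`!%:R : K)^-1 *: x ^+ (k - i)) *
                  ((i`!%:R : K)^-1 *: y ^+ i).
Proof.
move=> xy; rewrite exprDn_comm // scaler_sumr; apply: eq_bigr => i _.
rewrite -scalerAl -scalerAr scalerA -[_ * _ *+ _]scaler_nat scalerA.
congr (_ *: _).
have ik : (i <= k)%N by rewrite -ltnS.
rewrite -(bin_fact ik) !natrM.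
have bz : ('C(k, i)%:R : K) != 0 by rewrite pnatr_eq0 -lt0n bin_gt0.
by rewrite !invfM mulrC mulVKf // mulrC.
Qed.

(* The terms of the product of partial sums that lie outside the triangle;
   for commuting matrices they are dominated by the same terms for the norms. *)
Lemma exp_sum_defect (K : numFieldType) (L : algType K) (x y : L) n :
  x * y = y * x ->
  let e (z : L) k := (k`!%:R : K)^-1 *: z ^+ k in
  (\sum_(0 <= k < n) e x k) * (\sum_(0 <= k < n) e y k) -
  \sum_(0 <= k < n) e (x + y) k =
  \sum_(0 <= i < n) \sum_(n - i <= j < n) e x j * e y i.
Proof.
move=> xy e; rewrite -(sum_square (fun i j => e x j * e y i)); congr (_ - _).
  rewrite exchange_big /= mulr_suml; apply: eq_bigr => i _.
  by rewrite mulr_sumr.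
by apply: eq_bigr => k _; exact: exp_sum_convolution.
Qed.

End CauchyProduct.

(** * Functional equation, Lipschitz bounds and local injectivity of the exponential *)

Section ExponentialLaws.
Context {R : realType} {d : nat}.
Implicit Types (A B : 'M[R[i]]_d.+1).

(** The terms outside the triangle are bounded, up to the square of [d.+1], by those for the real
    numbers [norm1 A] and [norm1 B]; these tend to 0 by the functional equation of [expR]. *)
Lemma expmxD A B : A * B = B * A -> expmx (A + B) = expmx A * expmx B.
Proof.
move=> AB.
have AB_cvg : series (expmx_coeff A) n * series (expmx_coeff B) n @[n --> \oo]
    --> expmx A * expmx B by apply: cvg_mxM; exact: expmx_cvg.
apply: (cvg_mx_unique (expmx_cvg (A + B))).
apply: cvg_mx_close AB_cvg _.
pose a := norm1 A; pose b := norm1 B.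
pose s (x : R) n := series (exp_coeff x) n.
apply: (@squeeze_cvgr _ _ _ _ (fun=> 0)
   (fun n => (d.+1%:R * d.+1%:R) * (s a n * s b n - s (a + b) n))).
- near=> n; rewrite norm1_ge0 /=.
  have -> : series (expmx_coeff A) n * series (expmx_coeff B) n -
      series (expmx_coeff (A + B)) n =
      \sum_(0 <= i < n) \sum_(n - i <= j < n) expmx_coeff A j * expmx_coeff B i.
    exact: (exp_sum_defect _ AB).
  have -> : s a n * s b n - s (a + b) n =
      \sum_(0 <= i < n) \sum_(n - i <= j < n) exp_coeff a j * exp_coeff b i.
    (* The real coefficients are put in the form of scalings in [R^o], so that the same algebraic
       identity applies to the reals as an algebra over themselves. *)
    have ec x : exp_coeff x = (fun k => (k`!%:R)^-1 *: (x : R^o) ^+ k).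
      by apply/funext => k; rewrite /exp_coeff /= mulrC.
    by rewrite /s !ec; exact: (@exp_sum_defect R R^o a b n (mulrC _ _)).
  rewrite mulr_sumr; apply: le_trans (norm1_sum _ _ _) _.
  apply: ler_sum => i _; rewrite mulr_sumr.
  apply: le_trans (norm1_sum _ _ _) _; apply: ler_sum => j _.
  apply: le_trans (norm1M _ _) _; rewrite mulrACA.
  by rewrite ler_pM ?norm1_ge0 ?norm1_expmx_coeff.
- exact: cvg_cst.
have s_cvg x : s x @ \oo --> expR x by exact: is_cvg_series_exp_coeff.
have := cvgM (cvg_cst (d.+1%:R * d.+1%:R : R))
  (cvgB (cvgM (s_cvg a) (s_cvg b)) (s_cvg (a + b))).
by rewrite expRD subrr mulr0; exact.
Unshelve. all: by end_near. Qed.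

Lemma expmx0 : expmx (0 : 'M[R[i]]_d.+1) = 1.
Proof.
apply: (cvg_mx_unique (expmx_cvg 0)).
(* The empty partial sum is 0, so the sequence is constant only from index 1 on. *)
rewrite -(cvg_shiftS (series _)); apply: cvg_near_cst; near=> n.
rewrite /series /= big_nat_recl //= big1 ?addr0.
  by rewrite /expmx_coeff fact0 expr0 invr1 scale1r.
by move=> i _; rewrite /expmx_coeff expr0n scaler0.
Unshelve. all: by end_near. Qed.

Lemma expmx_mulrn A m : expmx (A *+ m) = expmx A ^+ m.
Proof.
elim: m => [|m IHm]; first by rewrite mulr0n expmx0 expr0.
rewrite mulrS expmxD ?IHm ?exprS //.
by rewrite mulrnAr mulrnAl.
Qed.

Lemma expmx_unit A : expmx A \is a GRing.unit.
Proof.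
apply/unitrP; exists (expmx (- A)).
have AN : - A * A = A * - A by rewrite mulrN mulNr.
split; first by rewrite -(expmxD AN) addNr expmx0.
by rewrite -(expmxD (esym AN)) addrN expmx0.
Qed.

Lemma norm1_subrX A B (r : R) k : norm1 A <= r -> norm1 B <= r ->
  norm1 (A ^+ k.+1 - B ^+ k.+1) <= k.+1%:R * r ^+ k * norm1 (A - B).
Proof.
move=> Ar Br; have r0 : 0 <= r by exact: le_trans (norm1_ge0 _) Ar.
elim: k => [|k IHk]; first by rewrite !expr1 mul1r expr0 mul1r.
have -> : A ^+ k.+2 - B ^+ k.+2 =
    A * (A ^+ k.+1 - B ^+ k.+1) + (A - B) * B ^+ k.+1.
  by rewrite (exprS A k.+1) (exprS B k.+1) mulrBr mulrBl addrA subrK.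
apply: le_trans (norm1D _ _) _.
have -> : k.+2%:R * r ^+ k.+1 * norm1 (A - B) =
    r * (k.+1%:R * r ^+ k * norm1 (A - B)) + norm1 (A - B) * r ^+ k.+1.
  by rewrite -natr1 exprS; ring.
apply: lerD; apply: le_trans (norm1M _ _) _.
  by rewrite ler_pM ?norm1_ge0.
rewrite ler_wpM2l ?norm1_ge0 //; apply: le_trans (norm1XS _ _) _.
by rewrite lerXn2r ?nnegrE ?norm1_ge0.
Qed.

(** A mean value inequality for [exp - id], whose derivative has size at most [expR r - 1] on the
    ball; it is proved term by term on the series. *)
Lemma expmx_sub_le A B (r : R) : norm1 A <= r -> norm1 B <= r ->
  norm1 (expmx A - expmx B - (A - B)) <= (expR r - 1) * norm1 (A - B).
Proof.
move=> Ar Br; have r0 : 0 <= r by exact: le_trans (norm1_ge0 _) Ar.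
have cvgAB : series (expmx_coeff A) n - series (expmx_coeff B) n - (A - B)
    @[n --> \oo] --> expmx A - expmx B - (A - B).
  by apply: cvg_mxB; [apply: cvg_mxB; exact: expmx_cvg | exact: cvg_cst].
apply: (norm1_cvg_le cvgAB); near=> n.
(* With at least two terms present, the orders 0 cancel and the orders 1 differ by exactly
   [A - B]. *)
have n2 : (2 <= n)%N by near: n; exact: nbhs_infty_ge.
rewrite -(subnK n2) addn2; set m := (n - 2)%N.
rewrite /series /= -sumrB !big_nat_recl //=.
rewrite /expmx_coeff !expr0 subrr add0r !expr1 (factS 0) fact0 muln1 invr1.
rewrite !scale1r addrC addKr.
apply: le_trans (norm1_sum _ _ _) _.
(* The term of order [k + 2] carries a factor [k + 2] from the difference of powers, which lowers
   the factorial by one step. *)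
apply: (@le_trans _ _ (\sum_(0 <= k < m) exp_coeff r k.+1 * norm1 (A - B))).
  apply: ler_sum => k _; rewrite -scalerBr norm1Z normc_invfact /exp_coeff /=.
  apply: le_trans (ler_wpM2l _ (norm1_subrX k.+1 Ar Br)) _.
    by rewrite invr_ge0 ler0n.
  rewrite !mulrA ler_wpM2r ?norm1_ge0 // mulrC ler_wpM2l ?exprn_ge0 //.
  rewrite (factS k.+1) natrM invfM mulrAC mulVf ?mul1r // pnatr_eq0 //.
rewrite -mulr_suml ler_wpM2r ?norm1_ge0 // lerBrDl.
have := sum_exp_coeff_le m.+1 r0; rewrite big_nat_recl //=.
by rewrite {1}/exp_coeff /= expr0 fact0 divr1.
Unshelve. all: by end_near. Qed.

Lemma expmx_lipschitz A B (r : R) : norm1 A <= r -> norm1 B <= r ->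
  norm1 (expmx A - expmx B) <= expR r * norm1 (A - B).
Proof.
move=> Ar Br; have := expmx_sub_le Ar Br.
have := norm1D (expmx A - expmx B - (A - B)) (A - B).
by rewrite subrK; lra.
Qed.

(* [expR r < 2] makes [exp - id] a strict contraction on the ball. *)
Lemma expmx_inj_ball A B (r : R) : expR r < 2 -> norm1 A <= r -> norm1 B <= r ->
  expmx A = expmx B -> A = B.
Proof.
move=> r2 Ar Br AB; have := expmx_sub_le Ar Br.
rewrite AB subrr sub0r norm1N => h; apply/eqP; rewrite -subr_eq0.
apply: contraTT r2 => /norm1_gt0 n0; rewrite -leNgt.
rewrite -(ler_pM2r n0) mulr_natl mulr2n.
by move: h; rewrite mulrBl mul1r lerBrDr.
Qed.

Lemma cvg_expmx {T : Type} (F : set_system T) {FF : Filter F}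
    (f : T -> 'M[R[i]]_d.+1) A :
  f @ F --> A -> expmx (f x) @[x --> F] --> expmx A.
Proof.
move=> fA; apply/cvg_norm1.
have nf : norm1 (f x) @[x --> F] --> norm1 A by exact: cvg_norm1_norm.
apply: (@squeeze_cvgr _ _ _ _ (fun=> 0)
  (fun x => expR (norm1 A + 1) * norm1 (f x - A))).
- near=> x; rewrite norm1_ge0 /=; apply: expmx_lipschitz; last by rewrite lerDl.
  by near: x; apply: (cvgr_le _ nf); rewrite ltrDl.
- exact: cvg_cst.
move/cvg_norm1 : fA => /(cvgM (cvg_cst (expR (norm1 A + 1)))).
by rewrite mulr0; exact.
Unshelve. all: by end_near. Qed.

End ExponentialLaws.

(** * The exponential on eigenvectors and the modulus of its eigenvalues *)

Section ScalarExponential.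
Context {R : realType}.

Lemma expmx_scalar_real d (x : R) :
  expmx (x%:C%:M : 'M[R[i]]_d.+1) = (expR x)%:C%:M.
Proof.
apply: (cvg_mx_unique (expmx_cvg _)); apply/cvg_norm1.
have serE n : series (expmx_coeff (x%:C%:M : 'M[R[i]]_d.+1)) n =
    (series (exp_coeff x) n)%:C%:M.
  rewrite /series /= !rmorph_sum /=; apply: eq_bigr => k _.
  rewrite /expmx_coeff -rmorphXn /= scale_scalar_mx /exp_coeff /=.
  have -> : (x ^+ k / k`!%:R)%:C = x%:C ^+ k * (k`!%:R)^-1.
    by rewrite rmorphM rmorphXn /= fmorphV rmorph_nat.
  by rewrite mulrC.
apply: (@squeeze_cvgr _ _ _ _ (fun=> 0)
  (fun n => d.+1%:R * `|series (exp_coeff x) n - expR x|)).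
- near=> n; rewrite norm1_ge0 /= serE -!rmorphB /= -scalemx1 norm1Z normcR.
  by rewrite norm1_1 mulrC.
- exact: cvg_cst.
have ex : series (exp_coeff x) @ \oo --> expR x by exact: is_cvg_series_exp_coeff.
have := cvgM (cvg_cst (d.+1%:R : R)) (cvg_norm (cvgB ex (cvg_cst (expR x)))).
by rewrite subrr normr0 mulr0; exact.
Unshelve. all: by end_near. Qed.

Lemma norm1_conj m n (A : 'M[R[i]]_(m, n)) : norm1 (map_mx conjc A) = norm1 A.
Proof.
apply: eq_bigr => i _; apply: eq_bigr => j _; rewrite mxE.
by case: (A i j) => a b; rewrite /normc /= sqrrN.
Qed.

Lemma expmx_conj d (A : 'M[R[i]]_d.+1) :
  expmx (map_mx conjc A) = map_mx conjc (expmx A).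
Proof.
apply: (cvg_mx_unique (expmx_cvg _)); apply/cvg_norm1.
have serE n : series (expmx_coeff (map_mx conjc A)) n =
    map_mx conjc (series (expmx_coeff A) n).
  rewrite /series /= rmorph_sum /=; apply: eq_bigr => k _.
  by rewrite /expmx_coeff map_mxZ /= rmorphXn fmorphV rmorph_nat.
under eq_fun do rewrite serE -map_mxB norm1_conj.
by apply/cvg_norm1; exact: expmx_cvg.
Qed.

(** The complex exponential, taken as that of a 1 by 1 matrix so that the matrix laws apply to
    it. *)
Definition expc (z : R[i]) : R[i] := expmx (z%:M : 'M[R[i]]_1) 0 0.

(** The squared modulus is the product of [exp z] with its conjugate, that is the exponential of the
    real number [z + z^*]. *)
Lemma normc_expc (z : R[i]) : normc (expc z) = expR (complex.Re z).
Proof.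
have E : expc z * (expc z)^* = (expR (complex.Re z) ^+ 2)%:C.
  have zC : GRing.comm (z%:M : 'M[R[i]]_1) (map_mx conjc z%:M).
    by rewrite map_scalar_mx; exact: comm_scalar_mx.
  have := expmxD zC; rewrite expmx_conj map_scalar_mx /= -raddfD /=.
  have -> : z + z^* = (complex.Re z + complex.Re z)%:C.
    by rewrite addcJ rmorphD /= mulr_natl mulr2n.
  rewrite expmx_scalar_real expRD => /matrixP/(_ 0 0).
  rewrite mxE mulr1n expr2 => ->; rewrite [RHS]mxE big_ord1 mxE.
  by [].
have /complexI : (normc (expc z) ^+ 2)%:C = (expR (complex.Re z) ^+ 2)%:C.
  by rewrite -E -sqr_normc normc_normr rmorphXn.
by move/eqP; rewrite eqrXn2 ?normc_ge0 ?expR_ge0 // => /eqP.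
Qed.

Lemma expmx_eigen d (A : 'M[R[i]]_d.+1) (z : R[i]) (v : 'rV[R[i]]_d.+1) :
  v *m A = z *: v -> v *m expmx A = expc z *: v.
Proof.
move=> vA; apply/eqP; rewrite -subr_eq0; apply/eqP/norm1_eq0.
pose s n := series (expmx_coeff (z%:M : 'M[R[i]]_1)) n 0 0.
have vS n : v *m series (expmx_coeff A) n = s n *: v.
  rewrite /s /series /= summxE mulmx_sumr scaler_suml; apply: eq_bigr => k _.
  rewrite /expmx_coeff -scalemxAr mxE -rmorphXn /= mxE mulr1n -scalerA.
  congr (_ *: _); elim: k => [|k IHk]; first by rewrite !expr0 mulmx1 scale1r.
  by rewrite !exprSr -[_ * A]/(_ *m A) mulmxA IHk -scalemxAl vA scalerA.
have /cvg_norm1 cA := expmx_cvg A.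
have /cvg_norm1 cz := expmx_cvg (z%:M : 'M[R[i]]_1).
have c0 : norm1 v * norm1 (series (expmx_coeff A) n - expmx A) +
    norm1 (series (expmx_coeff (z%:M : 'M[R[i]]_1)) n - expmx z%:M) * norm1 v
    @[n --> \oo] --> (0 : R).
  have := cvgD (cvgM (cvg_cst (norm1 v)) cA) (cvgM cz (cvg_cst (norm1 v))).
  by rewrite mulr0 mul0r addr0; exact.
apply/eqP; rewrite eq_le norm1_ge0 andbT.
apply: (ler_cvg_to (cvg_cst _) c0); near=> n.
have -> : v *m expmx A - expc z *: v =
    (s n - expc z) *: v - v *m (series (expmx_coeff A) n - expmx A).
  rewrite mulmxBr vS scalerBl opprB [RHS]addrC.
  by rewrite [RHS]addrA subrK.
apply: le_trans (norm1B _ _) _; rewrite addrC lerD ?norm1M // norm1Z.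
rewrite ler_wpM2r ?norm1_ge0 //; apply: le_trans (norm1_entry _ 0 0).
by rewrite !mxE.
Unshelve. all: by end_near. Qed.

(* Only the modulus of the eigenvalue of [exp (t X)] is controlled, which is
   why the eigenvalue has to be off the imaginary axis. *)
Lemma eigen_time_le d (X : 'M[R[i]]_d.+1) (alpha : R[i]) (t e : R) :
  eigenvalue X alpha -> e <= 2^-1 -> norm1 (expmx (t%:C *: X) - 1) <= e ->
  `|t| * `|complex.Re alpha| <= 2 * e.
Proof.
move=> /eigenvalueP[v vX v0] e2 le_e.
have e0 : 0 <= e by exact: le_trans (norm1_ge0 _) le_e.
have vt : v *m (t%:C *: X) = (t%:C * alpha) *: v.
  by rewrite -scalemxAr vX scalerA.
have nv := norm1_gt0 v0.
(* The eigenvector [v] is multiplied by this number under [exp (t X) - 1]; submultiplicativity of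
   [norm1] then bounds its modulus. *)
have ce : normc (expc (t%:C * alpha) - 1) <= e.
  rewrite -(ler_pM2r nv) -norm1Z scalerBl scale1r -(expmx_eigen vt).
  rewrite -{2}[v]mulmx1 -mulmxBr; apply: le_trans (norm1M _ _) _.
  by rewrite mulrC ler_wpM2r // ltW.
have := le_normcD (expc (t%:C * alpha) - 1) 1.
have := le_normcD (1 - expc (t%:C * alpha)) (expc (t%:C * alpha)).
rewrite !subrK normc1 -normcN opprB normc_expc -normrM.
have -> : complex.Re (t%:C * alpha) = t * complex.Re alpha.
  by case: alpha {vX vt ce} => a b /=; rewrite mul0r subr0.
move: (t * _) => x lo hi.
(* The tangent inequality at [x] gives [x <= e]; at [- x] it gives [- x <= 2 * e], because the
   inverse of [1 - e] is at most [1 + 2 * e] for [e <= 1/2]. *)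
have xe : 1 + x <= expR x := expR_ge1Dx x.
have Nxe : 1 - x <= expR (- x) := expR_ge1Dx (- x).
have lo' : 1 - e <= expR x by lra.
have inv : expR (- x) * expR x = 1 by rewrite -expRD addNr expR0.
have Nx : expR (- x) <= 1 + 2 * e.
  rewrite -(ler_pM2r (expR_gt0 x)) inv.
  have : (1 + 2 * e) * (1 - e) <= (1 + 2 * e) * expR x.
    by rewrite ler_wpM2l //; lra.
  apply: le_trans; nra.
by rewrite ler_norml; lra.
Qed.

End ScalarExponential.

(** * Recovering a power of a matrix from powers of its exponential *)

Section Moments.

(** The weights are the entries of the inverse of the Vandermonde matrix at the nodes
    [0, ..., n - 1], distinct in characteristic zero. *)
Lemma moment_weights (K : numFieldType) (n : nat) :
  exists w : 'I_n -> 'I_n -> K, forall (j k : 'I_n),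
    \sum_m w j m * m%:R ^+ k = (j == k)%:R.
Proof.
pose V : 'M[K]_n := Vandermonde n (\row_j j%:R).
have Vu : V \in unitmx.
  rewrite unitmxE det_Vandermonde unitfE; apply/prodf_neq0 => i _.
  apply/prodf_neq0 => j ij; rewrite !mxE subr_eq0 eqr_nat.
  by rewrite gtn_eqF.
exists (fun j m => invmx V m j) => j k.
have := mulmxV Vu => /matrixP/(_ k j); rewrite !mxE eq_sym => <-.
by apply: eq_bigr => m _; rewrite !mxE mulrC.
Qed.

Context {R : realType} {d : nat}.
Implicit Types (A : 'M[R[i]]_d.+1).

Local Notation power_sum A n := (\sum_(i < n) norm1 (A ^+ i)).

Lemma power_sum_ge0 A n : 0 <= power_sum A n.
Proof. by apply: sumr_ge0 => *; exact: norm1_ge0. Qed.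

(** As [eta <= 1], each further power at most doubles the sum of the norms. *)
Lemma power_growth A (eta : R) n : 0 <= eta <= 1 ->
  (forall k, norm1 (A ^+ (n + k)) <= eta * power_sum A (n + k)) ->
  forall k, norm1 (A ^+ (n + k)) <= eta * 2 ^+ k * power_sum A n.
Proof.
move=> /andP[eta0 eta1] An.
have ps k : power_sum A (n + k) <= 2 ^+ k * power_sum A n.
  elim: k => [|k IHk]; first by rewrite addn0 expr0 mul1r.
  rewrite addnS big_ord_recr /= exprS -mulrA.
  apply: le_trans (lerD (lexx _) (An k)) _.
  rewrite mulr_natl mulr2n; apply: lerD => //.
  by apply: le_trans IHk; rewrite ler_piMl ?power_sum_ge0.
move=> k; apply: le_trans (An k) _.
by rewrite -mulrA ler_wpM2l.
Qed.

(* A combination of [exp (m A)], [m <= d + 1], whose Taylor coefficients up to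
   order [d + 1] all vanish except the [j]-th one; the higher powers of [A] are
   small multiples of the lower ones. *)
Lemma exp_moment_le (w : 'I_d.+2 -> 'I_d.+2 -> R[i]) A (eta W : R) (j : 'I_d.+2) :
  (forall j k : 'I_d.+2, \sum_m w j m * m%:R ^+ k = (j == k)%:R) ->
  (forall j, \sum_m normc (w j m) <= W) -> 0 <= eta ->
  (forall k, norm1 (A ^+ (d.+2 + k)) <= eta * 2 ^+ k * power_sum A d.+2) ->
  norm1 (\sum_m w j m *: expmx A ^+ m - (j`!%:R)^-1 *: A ^+ j) <=
    W * expR (2 * d.+2%:R) * (eta * power_sum A d.+2).
Proof.
move=> wP wW eta0 Ak.
have W0 : 0 <= W by apply: le_trans (wW j); apply: sumr_ge0 => *; exact: normc_ge0.
(* The combination has Taylor coefficient [mu k / k!] at order [k]. *)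
pose mu k := \sum_m w j m * m%:R ^+ k.
have muW k : normc (mu k) <= W * d.+2%:R ^+ k.
  apply: le_trans (normc_sum _ _ _) _.
  apply: (@le_trans _ _ (\sum_m normc (w j m) * d.+2%:R ^+ k)); last first.
    by rewrite -mulr_suml ler_wpM2r ?exprn_ge0 // ler0n.
  apply: ler_sum => m _; rewrite normcM ler_wpM2l ?normc_ge0 //.
  have -> : m%:R ^+ k = ((m%:R : R) ^+ k)%:C by rewrite rmorphXn rmorph_nat.
  rewrite normcR ger0_norm ?exprn_ge0 ?ler0n // lerXn2r ?nnegrE ?ler0n //.
  by rewrite ler_nat ltnW.
have serE n : \sum_m w j m *: series (expmx_coeff (A *+ m)) n =
    \sum_(0 <= k < n) mu k *: expmx_coeff A k.
  under eq_bigr => m _ do rewrite /series /= scaler_sumr.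
  rewrite exchange_big /=; apply: eq_bigr => k _.
  rewrite scaler_suml; apply: eq_bigr => m _.
  rewrite /expmx_coeff !scalerA -[A *+ m]scaler_nat exprZn scalerA.
  by rewrite mulrAC.
have cvgS : \sum_m w j m *: series (expmx_coeff (A *+ m)) n @[n --> \oo] -->
    \sum_m w j m *: expmx A ^+ m.
  apply/cvg_norm1.
  apply: (@squeeze_cvgr _ _ _ _ (fun=> 0) (fun n => \sum_m normc (w j m) *
    norm1 (series (expmx_coeff (A *+ m)) n - expmx (A *+ m)))).
  - near=> n; rewrite norm1_ge0 /= -sumrB.
    apply: le_trans (norm1_sum _ _ _) _; apply: ler_sum => m _.
    by rewrite -scalerBr norm1Z expmx_mulrn.
  - exact: cvg_cst.
  rewrite -[X in _ --> X](@big1 R 0 +%R _ (index_enum 'I_d.+2) xpredT (fun=> 0)) //.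
  apply: cvg_big => [|m _]; first exact: add_continuous.
  have /cvg_norm1 c := expmx_cvg (A *+ m).
  by have := cvgM (cvg_cst (normc (w j m))) c; rewrite mulr0; exact.
have cvgS' : \sum_m w j m *: series (expmx_coeff (A *+ m)) n - (j`!%:R)^-1 *: A ^+ j
    @[n --> \oo] --> \sum_m w j m *: expmx A ^+ m - (j`!%:R)^-1 *: A ^+ j.
  exact: (cvg_mxB cvgS (cvg_cst _)).
suff bound p : norm1 (\sum_(0 <= k < d.+2 + p) mu k *: expmx_coeff A k -
    (j`!%:R)^-1 *: A ^+ j) <= W * expR (2 * d.+2%:R) * (eta * power_sum A d.+2).
  apply: (norm1_cvg_le cvgS'); near=> n.
  have n2 : (d.+2 <= n)%N by near: n; exact: nbhs_infty_ge.
  by rewrite serE -(subnKC n2); exact: bound.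
(* Among the orders below [d + 2] only [j] has a nonzero moment, and its term is the one subtracted;
   the tail remains. *)
rewrite (@big_cat_nat _ _ _ d.+2) ?leq_addr //= big_mkord (bigD1 j) //=.
have {1}-> : mu j = 1 by rewrite /mu wP eqxx.
rewrite big1 => [|k kj]; last first.
  by rewrite /mu wP eq_sym (negPf kj) scale0r.
rewrite scale1r addr0 addrAC subrr add0r -[X in \sum_(X <= _ < _) _]add0n big_addn addKn.
apply: le_trans (norm1_sum _ _ _) _.
apply: (@le_trans _ _ (\sum_(0 <= k < p) exp_coeff (2 * d.+2%:R) (k + d.+2)%N *
    (W * (eta * power_sum A d.+2)))).
  apply: ler_sum => k _; rewrite /expmx_coeff scalerA norm1Z normcM.
  rewrite normc_invfact /exp_coeff /= exprMn.
  (* The exponent of 2 is raised from [k] to [k + d + 2], so that the bounds become terms of the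
     real exponential series at [2 * (d + 2)]. *)
  apply: (@le_trans _ _ ((W * d.+2%:R ^+ (k + d.+2)) / (k + d.+2)`!%:R *
     (eta * 2 ^+ (k + d.+2) * power_sum A d.+2))).
    apply: ler_pM; rewrite ?mulr_ge0 ?normc_ge0 ?norm1_ge0 ?invr_ge0 ?ler0n //.
      by rewrite ler_wpM2r ?invr_ge0 ?ler0n.
    rewrite {1}addnC; apply: le_trans (Ak k) _.
    rewrite ler_wpM2r ?power_sum_ge0 // ler_wpM2l //.
    by rewrite ler_eXn2l ?leq_addr // ltr1n.
  by rewrite le_eqVlt; apply/orP; left; apply/eqP; ring.
rewrite -mulr_suml [leRHS]mulrAC -mulrA [leRHS]mulrA [leRHS]mulrC.
rewrite ler_wpM2r ?mulr_ge0 ?power_sum_ge0 //.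
apply: le_trans (sum_exp_coeff_le (p + d.+2) _); last by rewrite mulr_ge0 ?ler0n.
rewrite [leRHS](@big_cat_nat _ _ _ d.+2) ?leq_addl //=.
rewrite -[X in _ + \sum_(X <= _ < _) _]add0n [X in _ <= _ + X]big_addn addnK lerDr.
by apply: sumr_ge0 => k _; rewrite exp_coeff_ge0 ?mulr_ge0 ?ler0n.
Unshelve. all: by end_near. Qed.

End Moments.

(** * Bounding a matrix by the distance of its exponential to 1, uniformly under conjugation *)

Section LogBound.
Context {R : realType} {d : nat}.
Implicit Types (A X p : 'M[R[i]]_d.+1).

Local Notation power_sum A n := (\sum_(i < n) norm1 (A ^+ i)).

(** The base [d + 3] is one more than the bound [d + 2] on the norm of [E], as required by the
    recursion for [E ^+ m - 1]. *)
Lemma norm1_expr_sub1 (E : 'M[R[i]]_d.+1) (e : R) m :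
  norm1 (E - 1) <= e -> e <= 1 -> norm1 (E ^+ m - 1) <= d.+3%:R ^+ m * e.
Proof.
move=> Ee e1; have e0 : 0 <= e by exact: le_trans (norm1_ge0 _) Ee.
have nE : norm1 E <= d.+2%:R.
  have := norm1D (E - 1) 1; rewrite subrK norm1_1 => /le_trans; apply.
  by rewrite -[d.+2%:R]natr1 addrC lerD2l (le_trans Ee).
elim: m => [|m IHm]; first by rewrite expr0 subrr norm1_0 mul1r.
have -> : E ^+ m.+1 - 1 = (E ^+ m - 1) * E + (E - 1).
  by rewrite exprSr mulrBl mul1r addrA subrK.
apply: le_trans (norm1D _ _) _.
apply: (@le_trans _ _ (d.+3%:R ^+ m * e * d.+2%:R + d.+3%:R ^+ m * e)).
  apply: lerD; first by apply: le_trans (norm1M _ _) _; rewrite ler_pM ?norm1_ge0.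
  by apply: le_trans Ee _; rewrite ler_peMl // exprn_ege1 // ler1n.
have -> : d.+3%:R ^+ m.+1 = d.+3%:R ^+ m * (d.+2%:R + 1) :> R.
  by rewrite exprSr natr1.
by move: (_ ^+ m) (d.+2%:R) => x y; rewrite le_eqVlt; apply/orP; left; apply/eqP; ring.
Qed.

Lemma power_le_exp : exists2 G : R, 0 < G & forall A (eta e : R) (j : 'I_d.+1),
  0 <= eta -> e <= 1 ->
  (forall k, norm1 (A ^+ (d.+2 + k)) <= eta * 2 ^+ k * power_sum A d.+2) ->
  norm1 (expmx A - 1) <= e ->
  norm1 (A ^+ j.+1) <= G * (e + eta * power_sum A d.+2).
Proof.
have [w wP] := moment_weights R[i] d.+2.
have [W W0 wW] : exists2 W : R, 0 <= W & forall j, \sum_m normc (w j m) <= W.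
  exists (\sum_j \sum_m normc (w j m)) => [|j].
    by do 2!apply: sumr_ge0 => ? _; exact: normc_ge0.
  rewrite [leRHS](bigD1 j) //= lerDl; do 2!apply: sumr_ge0 => ? _.
  exact: normc_ge0.
have [a a0 ma] : exists2 a : R, 0 <= a & forall m : 'I_d.+2, d.+3%:R ^+ m <= a.
  exists (d.+3%:R ^+ d.+2) => [|m]; first by rewrite exprn_ge0 ?ler0n.
  by rewrite ler_eXn2l ?ltr1n // ltnW.
have [b b0 bE] : exists2 b : R, 0 <= b & expR (2 * d.+2%:R) = b.
  by exists (expR (2 * d.+2%:R)); rewrite ?expR_ge0.
have [F F0 jF] : exists2 F : R, 0 <= F & forall i : 'I_d.+1, (i.+1)`!%:R <= F.
  exists (d.+2)`!%:R => [|i]; first by rewrite ler0n.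
  by rewrite ler_nat; apply/leq_fact/leqW; exact: ltn_ord.
(* [F] bounds the factorials, [W] the weights, [a] the growth of [E ^+ m - 1], and [b] the tail of
   the series; the summand 1 makes the constant positive. *)
exists (F * W * (a + b) + 1); first by rewrite ltr_wpDl // !mulr_ge0 ?addr_ge0.
move=> A eta e i eta0 e1 Ak Ee.
have e0 : 0 <= e by exact: le_trans (norm1_ge0 _) Ee.
pose j : 'I_d.+2 := lift ord0 i.
have jE : j = i.+1 :> nat by [].
have := exp_moment_le j wP wW eta0 Ak; rewrite bE.
set S := \sum_m _; set K := power_sum A _ => mom.
have K0 : 0 <= K by exact: power_sum_ge0.
have nS : norm1 S <= W * (a * e).
  (* As [j] is not 0, the moment of order zero vanishes: the weights sum to 0, and 1 may be
     subtracted from every power. *)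
  have -> : S = \sum_m w j m *: (expmx A ^+ m - 1).
    under [RHS]eq_bigr => m _ do rewrite scalerBr.
    rewrite sumrB -scaler_suml.
    have := wP j ord0; under eq_bigr => m _ do rewrite expr0 mulr1.
    by move=> ->; rewrite scale0r subr0.
  apply: le_trans (norm1_sum _ _ _) _.
  apply: (@le_trans _ _ (\sum_m normc (w j m) * (a * e))); last first.
    by rewrite -mulr_suml; apply: ler_wpM2r (wW j); rewrite mulr_ge0.
  apply: ler_sum => m _; rewrite norm1Z ler_wpM2l ?normc_ge0 //.
  apply: le_trans (norm1_expr_sub1 m Ee e1) _.
  exact: ler_wpM2r.
have nA : norm1 ((j`!%:R)^-1 *: A ^+ j) <= W * (a * e) + W * b * (eta * K).
  rewrite -[X in norm1 X](subKr S); apply: le_trans (norm1B _ _) _.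
  exact: lerD nS mom.
move: nA; rewrite norm1Z normc_invfact mulrC ler_pdivrMr ?ltr0n ?fact_gt0 //.
rewrite jE => /le_trans; apply.
have h0 : 0 <= W * (a * e) + W * b * (eta * K).
  by rewrite !(addr_ge0, mulr_ge0).
apply: (@le_trans _ _ ((W * (a * e) + W * b * (eta * K)) * F)).
  by rewrite ler_wpM2l.
have -> : (F * W * (a + b) + 1) * (e + eta * K) =
    (W * (a * e) + W * b * (eta * K)) * F +
    (F * W * (b * e + a * (eta * K)) + (e + eta * K)) by ring.
by rewrite lerDl !(addr_ge0, mulr_ge0).
Qed.

(** An absorption argument: summing the bounds on the powers bounds their sum [K] by a constant plus
    at most [K / 2], hence by a constant; the bound on the first power then gives the claim. *)
Lemma log_bound : exists2 C : R, 0 < C & forall A (eta e : R),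
  0 <= eta <= 1 -> C * eta <= 1 -> e <= 1 ->
  (forall k, norm1 (A ^+ (d.+1 + k)) <= eta * power_sum A (d.+1 + k)) ->
  norm1 (expmx A - 1) <= e -> norm1 A <= C * (e + eta).
Proof.
have [G G0 GP] := power_le_exp.
pose D : R := d.+1%:R.
have D1 : 1 <= D by rewrite ler1n.
exists (G * (1 + 2 * D * (1 + G))).
  by rewrite mulr_gt0 // addr_gt0 ?mulr_gt0 ?addr_gt0 //; lra.
move=> A eta e eta01 Ceta e1 Ak Ee.
have e0 : 0 <= e by exact: le_trans (norm1_ge0 _) Ee.
have [eta0 eta1] := andP eta01.
have Ak' k : norm1 (A ^+ (d.+2 + k)) <= eta * 2 ^+ k * power_sum A d.+2.
  apply: power_growth => // {}k.
  by rewrite -[d.+2]addn1 -addnA; exact: Ak.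
have AG (j : 'I_d.+1) := GP A eta e j eta0 e1 Ak' Ee.
set K := power_sum A d.+2 in AG.
have K0 : 0 <= K by exact: power_sum_ge0.
(* The order zero contributes [D], the norm of the identity; each of the other [d + 1] orders obeys
   [AG]. *)
have KD : K <= D + D * (G * (e + eta * K)).
  rewrite {1}/K big_ord_recl expr0 norm1_1 lerD2l.
  apply: le_trans (ler_sum _ (fun j _ => AG j)) _.
  by rewrite sumr_const card_ord -mulr_natl.
have DG : D * G * eta <= 2^-1.
  have : 0 <= G * eta by rewrite mulr_ge0 // ltW.
  have : 0 <= D * G * G * eta by rewrite !mulr_ge0 // ?ltW //; lra.
  by move: Ceta; clear -D1 G0 e0; clearbody D; lra.
have K2 : K <= 2 * D * (1 + G).
  have : D * G * eta * K <= 2^-1 * K by rewrite ler_wpM2r.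
  have : D * G * e <= D * G by rewrite ler_piMr // mulr_ge0 ?ltW //; lra.
  by move: KD; clear -D1 G0 e0 K0; clearbody D K; lra.
have := AG ord0; rewrite expr1 => /le_trans; apply.
rewrite -mulrA ler_pM2l //.
have : eta * K <= eta * (2 * D * (1 + G)) by rewrite ler_wpM2l.
have : 0 <= 2 * D * (1 + G) * e by rewrite !mulr_ge0 //; lra.
by clear -D1 G0 e0 K0 eta0; clearbody D K; lra.
Qed.

(** By Cayley-Hamilton for the conjugate, whose characteristic polynomial is that of [X]; hence [c]
    does not depend on [p]. Each lower power comes with at least one factor [t]. *)
Lemma conj_power_bound X : exists2 c : R, 0 <= c &
  forall p (t : R), p \is a GRing.unit -> `|t| <= 1 ->
  let A := t%:C *: (p * X * p^-1) in
  forall k, norm1 (A ^+ (d.+1 + k)) <= c * `|t| * power_sum A (d.+1 + k).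
Proof.
pose q := char_poly X.
exists (\sum_(i < d.+1) normc q`_i).
  by apply: sumr_ge0 => i _; exact: normc_ge0.
move=> p t pu t1 A k; set Y := p * X * p^-1 in A *.
have YD : Y ^+ d.+1 = - \sum_(i < d.+1) q`_i *: Y ^+ i.
  have : horner_mx Y q = 0.
    have := horner_mx_uconj q X pu.
    by rewrite [horner_mx X q]Cayley_Hamilton mulmx0 mul0mx => <-.
  rewrite -[q in horner_mx _ q]coefK poly_def size_char_poly linear_sum /=.
  under eq_bigr => i _ do rewrite linearZ /= rmorphXn /= horner_mx_X.
  rewrite big_ord_recr /=.
  have -> : q`_d.+1 = 1.
    by have /monicP := char_poly_monic X; rewrite /lead_coef size_char_poly.
  by rewrite scale1r addrC => /eqP; rewrite addr_eq0 => /eqP.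
have AD : A ^+ (d.+1 + k) =
    - \sum_(i < d.+1) (q`_i * t%:C ^+ (d.+1 - i)) *: A ^+ (i + k).
  rewrite /A exprZn [Y ^+ (_ + _)]exprD YD mulNr scalerN; congr (- _).
  rewrite mulr_suml scaler_sumr; apply: eq_bigr => i _.
  rewrite exprZn !scalerA -scalerAl -exprD scalerA; congr (_ *: _).
  rewrite -mulrA -exprD addnA subnK ?(ltnW (ltn_ord i)) //.
  by rewrite mulrC.
rewrite AD norm1N; apply: le_trans (norm1_sum _ _ _) _.
rewrite -mulrA mulr_suml; apply: ler_sum => i _.
rewrite norm1Z normcM -mulrA ler_wpM2l ?normc_ge0 //.
apply: ler_pM; rewrite ?normc_ge0 ?norm1_ge0 //.
  rewrite -rmorphXn normcR normrX subSn -1?ltnS // exprS.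
  by rewrite ler_piMr // exprn_ile1.
have ik : (i + k < d.+1 + k)%N by rewrite ltn_add2r.
rewrite (bigD1 (Ordinal ik)) //= lerDl.
by apply: sumr_ge0 => *; exact: norm1_ge0.
Qed.

Lemma eigenvalue_conj X p (alpha : R[i]) : p \is a GRing.unit ->
  eigenvalue X alpha -> eigenvalue (p * X * p^-1) alpha.
Proof.
move=> pu /eigenvalueP[v vX v0]; apply/eigenvalueP; exists (v *m p^-1).
  by rewrite !mulmxA mulmxKV // vX -scalemxAl.
by apply: contra v0 => /eqP/(congr1 (mulmx^~ p)); rewrite mul0mx mulmxKV // => ->.
Qed.

(** The point is that [e] is chosen before [p]: only the eigenvalue and the characteristic
    polynomial enter, and both are invariant under conjugation. *)
Lemma conj_log_bound X (alpha : R[i]) (r : R) :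
  eigenvalue X alpha -> complex.Re alpha != 0 -> 0 < r ->
  exists2 e : R, 0 < e & forall p (t : R), p \is a GRing.unit ->
    norm1 (expmx (t%:C *: (p * X * p^-1)) - 1) <= e ->
    norm1 (t%:C *: (p * X * p^-1)) <= r.
Proof.
move=> aX a0 r0; have [C C0 CP] := log_bound.
have [c c0 cP] := conj_power_bound X.
pose a : R := 2 / `|complex.Re alpha|.
have ap : 0 <= a by rewrite divr_ge0.
(* With [e] the inverse of [M], the summands ensure in turn [e <= 1/2], [|t| <= a * e <= 1],
   [eta = c * (a * e) <= 1], [C * eta <= 1] and [C * (e + eta) <= r]. *)
pose M := 2 + a + c * a + C * (c * a) + C * (1 + c * a) / r.
have ca0 : 0 <= c * a by rewrite mulr_ge0.
have Cca0 : 0 <= C * (c * a) by rewrite mulr_ge0 // ltW.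
have Cr0 : 0 <= C * (1 + c * a) / r.
  by rewrite divr_ge0 ?mulr_ge0 ?addr_ge0 // ltW.
have M0 : 0 < M by rewrite /M; lra.
have leM x : x <= M -> x * M^-1 <= 1 by move=> xM; rewrite ler_pdivrMr // mul1r.
exists M^-1; first by rewrite invr_gt0.
move=> p t pu Ee; set e := M^-1 in leM Ee *.
have e0 : 0 < e by rewrite invr_gt0.
have e2 : e <= 2^-1.
  have : 2 * e <= 1 by apply: leM; rewrite /M; lra.
  by lra.
have := eigen_time_le (eigenvalue_conj pu aX) e2 Ee.
rewrite -ler_pdivlMr ?normr_gt0 // mulrAC -/a => te.
have t1 : `|t| <= 1.
  by apply: le_trans te (leM _ _); rewrite /M; lra.
set A := _ *: _.
have eta1 : c * (a * e) <= 1.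
  by rewrite mulrA leM // /M; lra.
have Ak k : norm1 (A ^+ (d.+1 + k)) <= c * (a * e) * power_sum A (d.+1 + k).
  apply: le_trans (cP p t pu t1 k) _.
  by rewrite ler_wpM2r ?power_sum_ge0 // ler_wpM2l.
have := CP A (c * (a * e)) e _ _ _ Ak Ee.
rewrite eta1 andbT mulr_ge0 ?mulr_ge0 ?(ltW e0) // => /(_ isT) h.
apply: le_trans (h _ _) _.
- have -> : C * (c * (a * e)) = C * (c * a) * e by ring.
  by apply: leM; rewrite /M; lra.
- by lra.
have : C * (1 + c * a) / r * e <= 1 by apply: leM; rewrite /M; lra.
rewrite mulrAC ler_pdivrMr // mul1r.
by have -> : C * (e + c * (a * e)) = C * (1 + c * a) * e by ring.
Qed.

End LogBound.

(** * Convergent subsequences of bounded matrix sequences *)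

Section Subsequences.

Lemma strict_mono_ge (f : nat -> nat) :
  {homo f : m n / (m < n)%N} -> forall n, (n <= f n)%N.
Proof.
by move=> fS; elim=> // n IHn; apply: leq_ltn_trans IHn (fS _ _ (ltnSn n)).
Qed.

Lemma cvg_strict_mono (f : nat -> nat) :
  {homo f : m n / (m < n)%N} -> f @ \oo --> \oo.
Proof.
move=> fS; apply/cvgnyPge => N; exists N => // n /= Nn.
exact: leq_trans (strict_mono_ge fS n).
Qed.

Context {R : realType}.

Lemma bounded_subseq (u : nat -> R) (b : R) : (forall n, `|u n| <= b) ->
  exists2 f : nat -> nat, {homo f : m n / (m < n)%N} & cvgn (u \o f).
Proof.
move=> ub; have [|f /increasing_seqP fS fc] := @bolzano_weierstrass R u.
  exists b; split; first exact: num_real.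
  by move=> x bx n _ /=; apply: le_trans (ub n) (ltW bx).
exists f => //; apply: homo_ltn => [m n p|n]; first exact: ltn_trans.
exact: fS.
Qed.

Lemma bounded_subseq_family (I : eqType) (s : seq I) (u : I -> nat -> R) (b : R) :
  (forall i n, `|u i n| <= b) ->
  exists2 f : nat -> nat, {homo f : m n / (m < n)%N} &
    forall i, i \in s -> cvgn (u i \o f).
Proof.
move=> ub; elim: s => [|i s [f fS fc]]; first by exists id.
have [g gS gc] := @bounded_subseq (u i \o f) b (fun n => ub i (f n)).
exists (f \o g) => [m n mn|j]; first exact/fS/gS.
rewrite inE => /predU1P[->//|/fc/cvg_ex[l fl]]; apply/cvg_ex; exists l.
by rewrite compA; exact: cvg_comp (cvg_strict_mono gS) fl.
Qed.

Lemma mx_bounded_subseq d (u : nat -> 'M[R[i]]_d.+1) (b : R) :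
  (forall n, norm1 (u n) <= b) ->
  exists f : nat -> nat, exists2 A : 'M[R[i]]_d.+1,
    {homo f : m n / (m < n)%N} & u \o f @ \oo --> A.
Proof.
move=> ub.
pose c (k : bool * ('I_d.+1 * 'I_d.+1)) n : R :=
  let z := u n k.2.1 k.2.2 in if k.1 then complex.Re z else complex.Im z.
have cb k n : `|c k n| <= b.
  apply: le_trans (ub n); apply: le_trans (norm1_entry _ k.2.1 k.2.2).
  by rewrite /c; case: k.1; [exact: normRe_le | exact: normIm_le].
have [f fS fc] := bounded_subseq_family (index_enum _) cb.
exists f, (\matrix_(i, j) (limn (c (true, (i, j)) \o f) +i*
                           limn (c (false, (i, j)) \o f))) => //.
apply: cvg_mx_ReIm => i j; rewrite mxE /=.
  exact: fc (true, (i, j)) (mem_index_enum _).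
exact: fc (false, (i, j)) (mem_index_enum _).
Qed.

End Subsequences.

(** * Conjugates of one-parameter groups, and the Lie algebra of the identity component *)

Section OneParam.
Context {R : realType} {d : nat}.
Implicit Types (A X p : 'M[R[i]]_d.+1).

Lemma cvg_mxZ {T : Type} (F : set_system T) {FF : Filter F} (a : T -> R)
    (f : T -> 'M[R[i]]_d.+1) (b : R) A :
  a @ F --> b -> f @ F --> A -> (a x)%:C *: f x @[x --> F] --> b%:C *: A.
Proof.
move=> ab fA.
have nf : norm1 (f x) @[x --> F] --> norm1 A by exact: cvg_norm1_norm.
move/cvg_norm1 : fA => fA; apply/cvg_norm1.
apply: (@squeeze_cvgr _ _ _ _ (fun=> 0)
  (fun x => `|a x - b| * norm1 (f x) + `|b| * norm1 (f x - A))).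
- near=> x; rewrite norm1_ge0 /=.
  have -> : (a x)%:C *: f x - b%:C *: A =
      (a x - b)%:C *: f x + b%:C *: (f x - A).
    by rewrite rmorphB scalerBl scalerBr addrA subrK.
  by apply: le_trans (norm1D _ _) _; rewrite !norm1Z !normcR.
- exact: cvg_cst.
have := cvgD (cvgM (cvg_norm (cvgB ab (cvg_cst b))) nf)
  (cvgM (cvg_cst `|b|) fA).
by rewrite subrr normr0 mul0r mulr0 addr0; exact.
Unshelve. all: by end_near. Qed.

Lemma expmx_conj_unit A p : p \is a GRing.unit ->
  expmx (p * A * p^-1) = p * expmx A * p^-1.
Proof.
move=> pu; apply: (cvg_mx_unique (expmx_cvg _)).
have -> : series (expmx_coeff (p * A * p^-1)) =
    (fun n => p * series (expmx_coeff A) n * p^-1).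
  apply/funext => n; rewrite /series /= mulr_sumr mulr_suml; apply: eq_bigr => k _.
  rewrite /expmx_coeff -scalerAr -scalerAl; congr (_ *: _).
  elim: k => [|k IHk]; first by rewrite !expr0 mulr1 divrr.
  by rewrite !exprSr IHk !mulrA mulrVK.
apply: cvg_mxM; last exact: cvg_cst.
by apply: cvg_mxM; [exact: cvg_cst | exact: expmx_cvg].
Qed.

Lemma conj_one_paramE X p : p \is a GRing.unit ->
  conj_set p (one_param X) = [set expmx (t%:C *: (p * X * p^-1)) | t in [set: R]].
Proof.
move=> pu; have E t : expmx (t%:C *: (p * X * p^-1)) =
    p * expmx (t%:C *: X) * p^-1.
  by rewrite -(expmx_conj_unit (t%:C *: X) pu) -scalerAr -scalerAl.
apply/seteqP; split => [M [h [t _ th] hM]|M [t _ tM]].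
  by exists t; rewrite // -hM -th E.
by rewrite -tM E; exists (expmx (t%:C *: X)) => //; exists t.
Qed.

(** A one-parameter subgroup is the continuous image of the real line and passes through 1, so it
    stays in the component of 1. *)
Lemma lie_algebra_component (L' : set 'M[R[i]]_d.+1) :
  lie_algebra (connected_component L' 1) = lie_algebra L'.
Proof.
apply/seteqP; split => Y Yl t; first exact: connected_component_sub (Yl t).
pose f (t : R) := expmx (t%:C *: Y).
exists (f @` setT); last by exists t.
split.
- by exists 0 => //; rewrite /f scale0r expmx0.
- by move=> _ [s _ <-]; exact: Yl.
apply: connected_continuous_connected.
  by apply/connected_intervalP.
apply: continuous_subspaceT => s; apply: cvg_expmx; apply: cvg_mxZ.
  exact: cvg_id.
exact: cvg_cst.
Qed.

End OneParam.

(** * The Lie algebra of the limit group is a real line *)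

Section LimitAlgebra.
Context {R : realType} {d : nat}.
Implicit Types (A X p : 'M[R[i]]_d.+1).

Lemma conj_neq0 X p : p \is a GRing.unit -> X != 0 -> p * X * p^-1 != 0.
Proof.
move=> pu; apply: contra => /eqP pX0; apply/eqP.
by rewrite -(mulKr pu X) -[p * X](mulrVK pu) pX0 mul0r mulr0.
Qed.

Lemma expR_quarter_lt2 : expR (4^-1) < 2 :> R.
Proof.
have h : 1 - 4^-1 <= expR (- 4^-1) :> R := expR_ge1Dx _.
have : (1 - 4^-1) * expR (4^-1) <= expR (- 4^-1) * expR (4^-1) :> R.
  by rewrite ler_wpM2r ?expR_ge0.
by rewrite -expRD addNr expR0; lra.
Qed.

(** A positive time is needed at which the one-parameter group of [A] is near 1 with exponent in the
    injectivity ball; [A] is then recovered by dividing by [s]. *)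
Lemma small_expmx A (e : R) : 0 < e -> exists2 s : R, 0 < s &
  norm1 (s%:C *: A) <= 4^-1 /\ norm1 (expmx (s%:C *: A) - 1) < e.
Proof.
move=> e0; have e4 := ltW expR_quarter_lt2.
(* On the ball of radius 1/4 the exponential is 2-Lipschitz, so [m <= e / 4] leaves a distance to 1
   of at most [e / 2]. *)
pose m := Num.min 4^-1 (e / 4).
have m0 : 0 < m by rewrite lt_min; apply/andP; split; [lra | rewrite divr_gt0].
have N0 : 0 < norm1 A + 1 by rewrite ltr_wpDl ?norm1_ge0.
have s0 : 0 < m / (norm1 A + 1) by rewrite divr_gt0.
exists (m / (norm1 A + 1)) => //.
have sA : norm1 ((m / (norm1 A + 1))%:C *: A) <= m.
  rewrite norm1Z normcR gtr0_norm // mulrAC ler_pdivrMr //.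
  by rewrite ler_pM2l // lerDl.
have [m4 me] : m <= 4^-1 /\ m <= e / 4 by rewrite /m !ge_min !lexx orbT.
have sA4 : norm1 ((m / (norm1 A + 1))%:C *: A) <= 4^-1 by exact: le_trans m4.
split => //.
have z4 : norm1 (0 : 'M[R[i]]_d.+1) <= 4^-1 by rewrite norm1_0 invr_ge0.
have := expmx_lipschitz sA4 z4; rewrite expmx0 subr0 => /le_lt_trans; apply.
apply: (@le_lt_trans _ _ (2 * m)); first by rewrite ler_pM ?expR_ge0 ?norm1_ge0.
by lra.
Qed.

Lemma local_limit_lie X (alpha : R[i]) (p : nat -> 'M[R[i]]_d.+1)
    (L' : set 'M[R[i]]_d.+1) :
  eigenvalue X alpha -> complex.Re alpha != 0 -> (forall n, GL R d (p n)) ->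
  chabauty_cvg (fun n => conj_set (p n) (one_param X)) L' ->
  exists2 Y : 'M[R[i]]_d.+1, Y != 0 &
    lie_algebra L' = [set a%:C *: Y | a in [set: R]].
Proof.
move=> aX a0 pu [L'lim L'sub].
pose X_ n := p n * X * (p n)^-1.
have X0 : X != 0.
  apply: contraNneq a0 => X0; have /eigenvalueP[v vX v0] := aX.
  move: vX; rewrite X0 mulmx0 => /esym/eqP; rewrite scaler_eq0 (negPf v0) orbF.
  by move=> /eqP ->.
have Xn0 n : 0 < norm1 (X_ n) by apply/norm1_gt0/conj_neq0 => //; exact: pu.
have conjE n : conj_set (p n) (one_param X) =
    [set expmx (t%:C *: X_ n) | t in [set: R]].
  by apply: conj_one_paramE; exact: pu.
(* The unit direction of the line of [X_ n]: the conjugates themselves may be unbounded, whereas the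
   directions have a convergent subsequence. *)
pose Y_ n := ((norm1 (X_ n))^-1)%:C *: X_ n.
have nY n : norm1 (Y_ n) = 1.
  rewrite norm1Z normcR ger0_norm ?invr_ge0 ?norm1_ge0 // mulVf //.
  by rewrite gt_eqF.
have XY n (t : R) : t%:C *: X_ n = (t * norm1 (X_ n))%:C *: Y_ n.
  rewrite /Y_ scalerA -rmorphM -mulrA divff ?mulr1 //.
  by rewrite gt_eqF.
have [psi [Y psiS YY]] : exists f : nat -> nat, exists2 A : 'M[R[i]]_d.+1,
    {homo f : m n / (m < n)%N} & Y_ \o f @ \oo --> A.
  by apply: (@mx_bounded_subseq R d Y_ 1) => n; rewrite nY.
have Y1 : norm1 Y = 1.
  have : norm1 ((Y_ \o psi) n) @[n --> \oo] --> norm1 Y by exact: cvg_norm1_norm.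
  under eq_fun do rewrite /= nY.
  by move=> /(cvg_unique (@norm_hausdorff _ R)); apply; exact: cvg_cst.
have Y0 : Y != 0.
  by apply: contra_eq_neq Y1 => ->; rewrite norm1_0 eq_sym oner_eq0.
exists Y => //; apply/seteqP; split => [Z LZ|_ [a _ <-] t]; last first.
  have -> : t%:C *: (a%:C *: Y) = (t * a)%:C *: Y by rewrite scalerA -rmorphM.
  (* The line of [Y] lies in the Lie algebra: a multiple of [Y_ n] has its exponential in the [n]-th
     conjugate, and the second Chabauty condition applies along [psi]. *)
  apply: (L'sub (fun n => expmx ((t * a)%:C *: Y_ n)) psi).
  - move=> n; rewrite conjE; exists (t * a / norm1 (X_ n)); first by [].
    by rewrite (XY n) divfK // gt_eqF.
  - exact: psiS.
  - exact: expmx_unit.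
  exact: (cvg_expmx (cvg_mxZ (cvg_cst (t * a)) YY)).
have [e e0 eP] := conj_log_bound aX a0 (r := 4^-1) ltac:(by rewrite invr_gt0).
have [s s0 [sZ4 sZe]] := small_expmx Z e0.
have [h hconj hZ] := L'lim _ (LZ s).
have /choice[t ht] n : exists t : R, expmx (t%:C *: X_ n) = h n.
  by have := hconj n; rewrite conjE => -[t _ th]; exists t.
(* The parameters [t n] were chosen arbitrarily, but [h n] is eventually within [e] of 1, so the
   uniform logarithm bound makes [(t n) X_ n] small. *)
have [N _ Nt] : \forall n \near \oo, norm1 ((t n)%:C *: X_ n) <= 4^-1.
  have hc : norm1 (h n - 1) @[n --> \oo] --> norm1 (expmx (s%:C *: Z) - 1).
    exact: (cvg_norm1_norm (cvg_mxB hZ (cvg_cst (1 : 'M[R[i]]_d.+1)))).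
  have hle : \forall n \near \oo, norm1 (h n - 1) <= e by exact: cvgr_le hc _ sZe.
  apply: filterS hle => n hn.
  by apply: eP; [exact: pu | rewrite -/(X_ n) ht].
(* The coordinate of the exponent of [h] along the unit direction [Y_]; the shift by [N] makes the
   bound hold for every index. *)
pose b n := t (psi (n + N)%N) * norm1 (X_ (psi (n + N)%N)).
have bb n : `|b n| <= 4^-1.
  have := Nt (psi (n + N)%N) 
    (leq_trans (leq_addl _ _) (strict_mono_ge psiS _)).
  by rewrite XY norm1Z normcR nY mulr1.
have [f fS /cvg_ex[c fc]] := bounded_subseq bb.
have addS : {homo addn^~ N : m n / (m < n)%N} by move=> m n; rewrite ltn_add2r.
have fN : (addn^~ N \o f) @ \oo --> \oo.
  exact: cvg_comp (cvg_strict_mono fS) (cvg_strict_mono addS).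
have YfN : Y_ (psi (f n + N)%N) @[n --> \oo] --> Y by exact: cvg_comp fN YY.
have hfN : h (psi (f n + N)%N) @[n --> \oo] --> expmx (s%:C *: Z).
  exact: cvg_comp (cvg_comp _ _ fN (cvg_strict_mono psiS)) hZ.
have E : expmx (s%:C *: Z) = expmx (c%:C *: Y).
  apply: (cvg_mx_unique hfN).
  have -> : (fun n => h (psi (f n + N)%N)) =
      (fun n => expmx ((b (f n))%:C *: Y_ (psi (f n + N)%N))).
    by apply/funext => n; rewrite -ht XY.
  exact: (cvg_expmx (cvg_mxZ fc YfN)).
have c4 : `|c| <= 4^-1.
  by apply: (ler_cvg_to (cvg_norm fc) (cvg_cst _)); near=> n; exact: bb.
have cY4 : norm1 (c%:C *: Y) <= 4^-1 by rewrite norm1Z normcR Y1 mulr1.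
(* Both exponents lie in the ball where [exp] is injective, so [s Z = c Y] and [Z] is a real
   multiple of [Y]. *)
have sZ := expmx_inj_ball expR_quarter_lt2 sZ4 cY4 E.
exists (s^-1 * c); first by [].
rewrite rmorphM -scalerA -sZ scalerA -rmorphM.
by rewrite (mulVf (lt0r_neq0 s0)) rmorph1 scale1r.
Unshelve. all: by end_near. Qed.

End LimitAlgebra.

Theorem theorem1p4 (R : realType) (d : nat) (X : 'M[R[i]]_d.+1) (alpha : R[i])
    (hX : eigenvalue X alpha) (halpha : complex.Re alpha != 0)
    (L : set 'M[R[i]]_d.+1) (hL : local_limit (one_param X) L) :
  real_lie_dim L 1.
Proof.
have [p [L' [pu _ L'lim ->]]] := hL.
have [Y Y0 LY] := local_limit_lie hX halpha pu L'lim.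
exists (fun=> Y); split => [c|].
  rewrite big_ord1 => /eqP; rewrite scaler_eq0 (negPf Y0) orbF => /eqP c0 i.
  by rewrite ord1; apply: complexI.
rewrite lie_algebra_component LY; apply/seteqP.
split => _ [c _ <-]; last by exists (c ord0) => //; rewrite big_ord1.
by exists (fun=> c) => //; rewrite big_ord1.
Qed.
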